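(* Let $(X,E,B,\tilde B)$ be an admissible quadruple. Suppose $\tilde B$ is a Ditkin algebra. Then $E$ and $B$ are Ditkin algebras.
   Context: Banach algebras are over $\mathbb{C}$. For a commutative Banach algebra $A$ with unit, $M(A)$ is the set of nonzero multiplicative linear functionals $A\to\mathbb{C}$ with the relative weak-star topology from $A^*$, and $\hat a(\phi)=\phi(a)$. The support $\mathrm{supp}(a)$ of $a\in A$ is the closure in $M(A)$ of $\{\phi\in M(A):\hat a(\phi)\ne0\}$. For $\phi\in M(A)$ put $I_\phi=\{a\in A:\hat a(\phi)=0\}$ and $J_\phi=\{a\in A:\phi\notin\mathrm{supp}(a)\}$. $A$ is a Ditkin algebra if for every $\phi\in M(A)$ and every $a\in I_\phi$, $a$ belongs to the norm closure of $aJ_\phi=\{ab:b\in J_\phi\}$. $C(X,E)$ is the algebra of all continuous maps $X\to E$ with pointwise operations, and $C(X)=C(X,\mathbb{C})$. An $E$-valued function algebra on $X$ is a subalgebra $A\subset C(X,E)$, equipped with some norm that makes it complete, such that (1) $A$ contains the constant function $x\mapsto 1_E$; (2) $A$ separates the points of $X$; (3) for each $x\in X$ the evaluation map $e_x:A\to E$, $f\mapsto f(x)$, is continuous. A $\mathbb{C}$-valued function algebra $B$ on $X$ is natural if every element of $M(B)$ is evaluation at a point of $X$. An admissible quadruple is a quadruple $(X,E,B,\tilde B)$ where: $X$ is a compact Hausdorff space; $E$ is a commutative Banach algebra with unit; $B\subset C(X)$ is a natural $\mathbb{C}$-valued function algebra on $X$; $\tilde B\subset C(X,E)$ is an $E$-valued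 function algebra on $X$; $B\cdot E\subset\tilde B$ (that is, $x\mapsto g(x)a$ belongs to $\tilde B$ for all $g\in B$, $a\in E$); and $\{\lambda\circ f: f\in\tilde B,\ \lambda\in M(E)\}\subset B$. *)

(* Defs.v *)
From HB Require Import structures.
From mathcomp Require Import all_boot all_order all_algebra.
From mathcomp Require Import all_classical all_reals all_analysis.
From mathcomp Require Import complex ring lra.

Set Implicit Arguments.
Unset Strict Implicit.
Unset Printing Implicit Defensive.

Import Order.TTheory GRing.Theory Num.Theory.
Import numFieldNormedType.Exports.

Local Open Scope classical_set_scope.
Local Open Scope ring_scope.

(* Complex numbers as a numClosedFieldType, so that they inherit the topology
   and norm that MathComp-Analysis puts on every numFieldType. *)
Definition Cplx (R : realType) : numClosedFieldType := R[i].

(* A plain record, because HB rejects a structure joining comAlgType with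
   normedModType: numDomainType would have to inherit from part of that join.
   The norm is not required to be submultiplicative here: the norm of a
   function algebra is only assumed complete.  As for every comAlgType,
   1 != 0. *)
Record comCompleteAlg (K : numFieldType) := ComCompleteAlg {
  cca_space : completeNormedModType K;
  cca_mul : cca_space -> cca_space -> cca_space;
  cca_one : cca_space;
  cca_mulA : associative cca_mul;
  cca_mulC : commutative cca_mul;
  cca_mul1 : left_id cca_one cca_mul;
  cca_mulDl : left_distributive cca_mul +%R;
  cca_one_neq0 : cca_one != 0;
  cca_scaleAl : forall (k : K) (a b : cca_space),
    k *: cca_mul a b = cca_mul (k *: a) b
}.

Definition cca_sort (K : numFieldType) (A : comCompleteAlg K) : Type :=
  cca_space A.
Coercion cca_sort : comCompleteAlg >-> Sortclass.

HB.instance Definition _ (K : numFieldType) (A : comCompleteAlg K) :=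
  CompleteNormedModule.copy (cca_sort A) (cca_space A).
HB.instance Definition _ (K : numFieldType) (A : comCompleteAlg K) :=
  GRing.Zmodule_isComNzRing.Build (cca_sort A)
    (@cca_mulA K A) (@cca_mulC K A) (@cca_mul1 K A) (@cca_mulDl K A)
    (@cca_one_neq0 K A).
HB.instance Definition _ (K : numFieldType) (A : comCompleteAlg K) :=
  GRing.Lmodule_isLalgebra.Build K (cca_sort A) (@cca_scaleAl K A).
HB.instance Definition _ (K : numFieldType) (A : comCompleteAlg K) :=
  GRing.Lalgebra_isComAlgebra.Build K (cca_sort A).

Record comBanachAlg (K : numFieldType) := ComBanachAlg {
  cba_alg :> comCompleteAlg K;
  cba_normM : forall a b : cba_alg, `|a * b| <= `|a| * `|b|
}.

Lemma Cplx_complete (R : realType) (F : set_system (Cplx R)) :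
  ProperFilter F -> cauchy F -> cvg F.
Proof.
move=> FF /cauchy_ballP Fc.
have norm_Im (z : R[i]) : `|complex.Im z|%:C%C <= `|z|.
  rewrite normc_def lecR -sqrtr_sqr ler_wsqrtr// lerDr sqr_ge0 //.
have cvg_part (p : {additive R[i] -> R}) :
    (forall z : R[i], `|p z|%:C%C <= `|z|) -> cvg ((p : Cplx R -> R) @ F).
  move=> pn; apply: R_complete; apply/cauchy_ballP => e e0.
  have e0C : (0 : Cplx R) < e%:C%C by rewrite -[0]/(0%:C%C) ltcR.
  have := Fc _ e0C; rewrite !near_simpl /= => -[[P Q] [FP FQ] PQ].
  exists (p @` P, p @` Q) => /=.
    by split; [apply: filterS FP|apply: filterS FQ] => x Px; exists x.
  move=> [_ _] [/= [x Px <-] [y Qy <-]].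
  have /= := PQ (x, y) (conj Px Qy).
  rewrite -!ball_normE /= -raddfB -ltcR; apply: le_lt_trans; exact: pn.
have /cvg_ex [a Fa] := cvg_part (@complex.Re R : {additive R[i] -> R})
  (@normc_ge_Re R).
have /cvg_ex [b Fb] := cvg_part (@complex.Im R : {additive R[i] -> R}) norm_Im.
apply/cvg_ex; exists ((a +i* b)%C : Cplx R).
apply/cvgrPdist_lt => e e0.
have [r r0 er] : exists2 r : R, 0 < r & e = r%:C%C.
  case: e e0 => r s; rewrite ltcE /= => /andP[/eqP -> r0].
  by exists r.
have r20 : 0 < r / 2 by rewrite divr_gt0.
move/cvgrPdist_lt: Fa => /(_ _ r20) Fa.
move/cvgrPdist_lt: Fb => /(_ _ r20) Fb.
near=> z.
have za : `|a - complex.Re (z : R[i])| < r / 2 by near: z.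
have zb : `|b - complex.Im (z : R[i])| < r / 2 by near: z.
rewrite er normc_def ltcR.
move: za zb; case: (z) => x y /= za zb.
rewrite -(@ger0_norm _ r) ?ltW// -sqrtr_sqr ltr_sqrt ?exprn_gt0//.
rewrite -[(a - x) ^+ 2]real_normK ?num_real// -[(b - y) ^+ 2]real_normK ?num_real//.
have := normr_ge0 (a - x); have := normr_ge0 (b - y); nra.
Unshelve. all: by end_near. Qed.

(* An alias, since completeness is not available on every numClosedFieldType. *)
Definition Cplx_space (R : realType) : Type := Cplx R.

HB.instance Definition _ (R : realType) :=
  NormedModule.copy (Cplx_space R) (Cplx R).
HB.instance Definition _ (R : realType) :=
  Uniform_isComplete.Build (Cplx_space R) (@Cplx_complete R).

Section ComplexAlgebra.
Variable R : realType.

Let scaleAl (k a b : Cplx R) : k *: (a * b) = (k *: a) * b.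
Proof. exact: mulrA. Qed.

Definition Cplx_cca : comCompleteAlg (Cplx R) :=
  @ComCompleteAlg (Cplx R) (Cplx_space R)
    *%R 1 (@mulrA _) (@mulrC _) (@mul1r _) (@mulrDl _) (@oner_neq0 _) scaleAl.

Let normM (a b : Cplx_cca) : `|a * b| <= `|a| * `|b|.
Proof. by rewrite [`|a * b|](@normrM (Cplx R)). Qed.

Definition Cplx_alg : comBanachAlg (Cplx R) := ComBanachAlg normM.

End ComplexAlgebra.

Section Gelfand.
Variables (R : realType) (A : comCompleteAlg (Cplx R)).

(* {ptws A -> _} carries the topology of pointwise convergence, which restricts
   to the weak-star topology on bounded functionals.  Boundedness is not part
   of the definition: it is automatic for characters of a Banach algebra. *)
Definition characters : set {ptws A -> Cplx R} :=
  [set phi | [/\ scalar phi, (forall a b, phi (a * b) = phi a * phi b)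
               & exists a, phi a != 0]].

(* The library gives set_type the relative topology. *)
Definition char_space : topologicalType := set_type characters.

Definition gelfand (a : A) (phi : char_space) : Cplx R := val phi a.

Definition supp (a : A) : set char_space :=
  closure [set phi | gelfand a phi != 0].

Definition I_at (phi : char_space) : set A := [set a | gelfand a phi = 0].

Definition J_at (phi : char_space) : set A := [set a | ~ supp a phi].

Definition ditkin : Prop :=
  forall (phi : char_space) (a : A),
    I_at phi a -> closure [set a * b | b in J_at phi] a.

End Gelfand.

(* The subalgebra is the range of [fa_val], and the complete norm on it is the
   one of [fa_alg].  [monoid_morphism] includes that 1 is sent to the constant
   function 1, so condition (1) on function algebras. *)
Record function_algebra (R : realType) (X : topologicalType)
    (E : comBanachAlg (Cplx R)) := FunctionAlgebra {
  fa_alg :> comCompleteAlg (Cplx R);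
  fa_val : fa_alg -> (X -> E);
  fa_inj : injective fa_val;
  fa_linear : linear fa_val;
  fa_mult : monoid_morphism fa_val;
  fa_continuous : forall f, continuous (fa_val f);
  fa_separates : forall x y, x != y -> exists f, fa_val f x != fa_val f y;
  fa_eval_continuous : forall x, continuous (fun f => fa_val f x)
}.

Section Admissible.
Variables (R : realType) (X : topologicalType).

Definition fa_set (E : comBanachAlg (Cplx R)) (A : function_algebra X E) :
  set (X -> E) := range (@fa_val _ _ _ A).

Definition natural (B : function_algebra X (Cplx_alg R)) : Prop :=
  forall phi : char_space B, exists x, forall f, gelfand f phi = fa_val f x.

(* No hypothesis that X is nonempty is needed: 1 != 0 in [fa_alg] forces it. *)
Definition admissible (E : comBanachAlg (Cplx R))
    (B : function_algebra X (Cplx_alg R)) (Bt : function_algebra X E) : Prop :=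
  [/\ compact [set: X], hausdorff_space X, natural B,
      forall g a, fa_set B g -> fa_set Bt (fun x => (g x : Cplx R) *: a) &
      forall f (lam : char_space E), fa_set Bt f ->
        fa_set B (fun x => gelfand (f x) lam)].

End Admissible.

(* Main.v *)
Require Import Defs.
From mathcomp Require Import all_boot all_order all_algebra.
From mathcomp Require Import all_classical all_reals all_analysis.
From mathcomp Require Import complex ring lra.

(* A unital homomorphism h : A' -> A that is continuous and has a right inverse
   transports the Ditkin property from A' to A: characters of A pull back along
   h, continuously for the topology of pointwise convergence, so h maps
   J_(phi o h) into J_phi, and Ditkin approximations of a preimage of [a] are
   sent to Ditkin approximations of [a].  For E take the evaluation of Bt at a
   point, with the constant functions as right inverse; for B take
   f |-> lam o f with lam a character of E, with right inverse g |-> g * 1_E.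
   The latter is continuous by the closed graph theorem.

   A character of E is obtained from a minimal submultiplicative seminorm p
   with p 1 >= 1 (Zorn).  Minimality forces p to be multiplicative, and then
   Ostrowski's argument gives for each [a] a scalar z with p (a - z) = 0;
   the map a |-> z is the character. *)

Set Implicit Arguments.
Unset Strict Implicit.
Unset Printing Implicit Defensive.

Import Order.TTheory GRing.Theory Num.Theory.
Import numFieldNormedType.Exports.

Local Open Scope classical_set_scope.
Local Open Scope ring_scope.

(** * The norm as a real number, and the closed graph theorem *)

Section RealNorm.
Variable R : realType.

(** Norms take values in [Cplx R], whose order is only partial. A nonnegative element there is real,
    so its real part loses nothing and gives access to infima and real arithmetic. *)
Definition nrm (V : normedZmodType (Cplx R)) (x : V) : R :=
  complex.Re (`|x| : R[i]).

Section Zmod.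
Variable V : normedZmodType (Cplx R).
Implicit Types x y : V.

Lemma nrmE x : `|x| = ((nrm x)%:C%C : Cplx R).
Proof.
have : (0 : Cplx R) <= `|x| by [].
by rewrite /nrm; case: (`|x|) => a b; rewrite lecE /= => /andP[/eqP -> _].
Qed.

Lemma nrm_ge0 x : 0 <= nrm x.
Proof. by have : (0 : Cplx R) <= `|x| by []; rewrite nrmE lecR. Qed.

Lemma nrmD x y : nrm (x + y) <= nrm x + nrm y.
Proof. by rewrite -lecR rmorphD /= -!nrmE; exact: ler_normD. Qed.

Lemma nrm0 : nrm (0 : V) = 0.
Proof. by rewrite /nrm normr0. Qed.

Lemma nrm_eq0 x : (nrm x == 0) = (x == 0).
Proof. by rewrite -(inj_eq (@complexI R)) -nrmE normr_eq0. Qed.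

Lemma nrmN x : nrm (- x) = nrm x.
Proof. by rewrite /nrm normrN. Qed.

Lemma nrmB x y : nrm (x - y) = nrm (y - x).
Proof. by rewrite /nrm distrC. Qed.

Lemma nrm_triangle z x y : nrm (x - y) <= nrm (x - z) + nrm (z - y).
Proof. by rewrite -[x in leLHS](subrK z) -addrA nrmD. Qed.

End Zmod.

Lemma nrmM (z w : Cplx R) : nrm (z * w) = nrm z * nrm w.
Proof.
have : `|z * w| = `|z| * `|w| by exact: normrM.
by rewrite !nrmE -rmorphM => -[].
Qed.

Lemma nrmC_ge0 (r : R) : 0 <= r -> nrm (r%:C%C : Cplx R) = r.
Proof. by move=> r0; rewrite /nrm ger0_norm// lecR. Qed.

Lemma nrmX (z : Cplx R) n : nrm (z ^+ n) = nrm z ^+ n.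
Proof.
elim: n => [|n IH]; first by rewrite !expr0 nrmC_ge0.
by rewrite !exprS nrmM IH.
Qed.

Lemma nrmZ (V : normedModType (Cplx R)) (z : Cplx R) (x : V) :
  nrm (z *: x) = nrm z * nrm x.
Proof.
have : `|z *: x| = `|z| * `|x| by exact: normrZ.
by rewrite !nrmE -rmorphM => -[].
Qed.

Lemma nbhs_nrmP (V : normedModType (Cplx R)) (x : V) (A : set V) :
  nbhs x A <-> exists2 e : R, 0 < e & forall y, nrm (x - y) < e -> A y.
Proof.
split=> [/nbhs_normP[e /= e0 eA]|[e e0 eA]].
  case: e e0 eA => r s; rewrite ltcE /= => /andP[/eqP -> r0] rA.
  by exists r => // y xy; apply: rA; rewrite /= nrmE ltcR.
apply/nbhs_normP; exists (e%:C%C); first by rewrite /= ltcR.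
by move=> y /=; rewrite nrmE ltcR; exact: eA.
Qed.

(** * Completeness: geometric sequences, Baire category, closed graph theorem *)

Lemma geometric_small (c e : R) : 0 <= c -> 0 < e -> exists n, c / 2 ^+ n < e.
Proof.
move=> c0 e0; have c1 : 0 < c + 1 by lra.
have ec : 0 < e / (c + 1) by rewrite divr_gt0.
have [n _ /(_ n (leqnn n)) /=] := near_infty_natSinv_expn_lt (PosNum ec).
rewrite /= ltr_pdivlMr// => H; exists n; apply: le_lt_trans H.
by rewrite div1r mulrC ler_wpM2l ?invr_ge0 ?exprn_ge0//; lra.
Qed.

(** The hypotheses bound each step by [rho n - rho n.+1], so distances telescope and [rho n] bounds
    the whole tail from [n] on. *)
Lemma geometric_limit (V : completeNormedModType (Cplx R)) (u : nat -> V)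
    (rho : nat -> R) :
  (forall n, nrm (u n.+1 - u n) <= rho n / 2) ->
  (forall n, rho n.+1 <= rho n / 2) ->
  exists l, forall n, nrm (l - u n) <= rho n.
Proof.
move=> u_step rho_step.
have rho0 n : 0 <= rho n.
  by have := le_trans (nrm_ge0 _) (u_step n); lra.
have rho_geo n : rho n <= rho 0%N / 2 ^+ n.
  elim: n => [|n IH]; first by rewrite expr0 divr1.
  by rewrite exprSr invfM mulrA (le_trans (rho_step n))// ler_pM2r.
have u_dist n k : nrm (u (k + n)%N - u n) <= rho n - rho (k + n)%N.
  elim: k => [|k IH]; first by rewrite !subrr nrm0.
  rewrite addSn (le_trans (nrm_triangle (u (k + n)%N) _ _))//.
  by have := u_step (k + n)%N; have := rho_step (k + n)%N; lra.
have /cvg_ex[l ul] : cvg (u @ \oo).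
  apply: cauchy_cvg; apply: cauchy_exP => e e0.
  have [r r0 er] : exists2 r : R, 0 < r & e = r%:C%C.
    case: e e0 => r s; rewrite ltcE /= => /andP[/eqP -> r0].
    by exists r.
  have [n nr] := geometric_small (rho0 0%N) r0.
  exists (u n); exists n => // m /= nm.
  rewrite -ball_normE /= nrmE er ltcR nrmB -(subnK nm).
  apply: le_lt_trans nr; apply: le_trans (rho_geo n).
  by rewrite (le_trans (u_dist _ _))// lerBlDr lerDl.
exists l => n; apply/ler_addgt0Pr => e e0.
have : nbhs l [set y | nrm (l - y) < e].
  by apply/nbhs_nrmP; exists e.
move=> /ul[N _ Nl].
have le : nrm (l - u (N + n)%N) < e by apply: Nl; rewrite /= leq_addr.
rewrite [_ + e]addrC (le_trans (nrm_triangle (u (N + n)%N) _ _))//.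
rewrite lerD ?(ltW le)// (le_trans (u_dist _ _))// lerBlDr lerDl//.
Qed.

(** Baire's theorem: if no [W n] were dense in a ball, one could nest closed balls, each avoiding
    the next [W n], and their common point would escape the cover. *)
Lemma nrm_baire (V : completeNormedModType (Cplx R)) (W : nat -> set V) :
  (forall x, exists n, W n x) ->
  exists n (x : V) (r : R), 0 < r /\
    forall y, nrm (y - x) < r -> forall e, 0 < e ->
      exists2 w, W n w & nrm (y - w) < e.
Proof.
move=> Wcover; apply/not_existsP => nowhere.
(* The triple [t] holds the stage, the centre and the radius. The guard on the radius makes the
   statement hold for every [t], as [choice] requires; without it the value is arbitrary. *)
have next (t : nat * V * R) : exists q : V * R, 0 < t.2 ->
    [/\ nrm (q.1 - t.1.2) <= t.2 / 2, 0 < q.2, q.2 <= t.2 / 2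
      & forall w, nrm (w - q.1) <= q.2 -> ~ W t.1.1 w].
  case: t => -[n x] r /=.
  have [r0|r0] := boolP (0 < r); last by exists (x, r).
  have /existsNP[y /not_implyP[yx /existsNP[e /not_implyP[e0 Wy]]]] :
      ~ forall y, nrm (y - x) < r / 2 -> forall e, 0 < e ->
      exists2 w, W n w & nrm (y - w) < e.
    move=> H; apply: (nowhere n); exists x, (r / 2); split=> //.
    by rewrite divr_gt0.
  exists (y, Num.min (e / 2) (r / 2)) => _ /=; split.
  - exact: ltW.
  - by rewrite lt_min !divr_gt0.
  - by rewrite ge_min lexx orbT.
  - move=> w; rewrite le_min => /andP[we _] Ww; apply: Wy; exists w => //.
    by rewrite nrmB; lra.
have [f fP] := choice next.
pose q := fix q n := if n is m.+1 then f (m, (q m).1, (q m).2) else (0 : V, 1 : R).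
have q0 n : 0 < (q n).2.
  by elim: n => [|n IH] //=; have [] := fP (n, (q n).1, (q n).2) IH.
have qP n := fP (n, (q n).1, (q n).2) (q0 n).
have [l lq] : exists l, forall n, nrm (l - (q n).1) <= (q n).2.
  by apply: geometric_limit => n; have [] := qP n.
have [n Wl] := Wcover l.
(* The ball avoiding [W n] is the one built from stage [n], hence the index [n.+1]. *)
by have [_ _ _ /(_ l)] := qP n; apply => //; exact: lq n.+1.
Qed.

(** By Baire, some set where [T] is bounded is dense in a ball. Recentring and rescaling give
    approximations near 0 with controlled image; summing successive corrections bounds [T] itself,
    the closed graph identifying the limit. *)
Lemma closed_graph (V W : completeNormedModType (Cplx R)) (T : V -> W) :
  linear T ->
  (forall f h, (forall e, 0 < e -> exists g, nrm (f - g) < e /\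
     nrm (h - T g) < e) -> h = T f) ->
  continuous T.
Proof.
move=> Tlin graphT.
have TB x y : T (x - y) = T x - T y.
  by rewrite -scaleN1r addrC Tlin scaleN1r addrC.
have TZ (c : Cplx R) x : T (c *: x) = c *: T x.
  by rewrite -[c *: x]addr0 Tlin -(subrr x) TB subrr addr0.
have T0 : T 0 = 0 by rewrite -(subrr 0) TB subrr.
have [n [x [r [r0 ballr]]]] :
    exists n (x : V) (r : R), 0 < r /\
      forall y, nrm (y - x) < r -> forall e, 0 < e ->
      exists2 w, nrm (T w) <= n%:R & nrm (y - w) < e.
  apply: (@nrm_baire V (fun n => [set w | nrm (T w) <= n%:R])) => y.
  by exists (Num.truncn (nrm (T y))).+1; rewrite /= ltW// truncnS_gt.
(* A vector near 0 is approximated by the difference of approximations of [y + x] and [x], hence the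
   factor 2. *)
set M : R := 2 * n%:R.
have approx0 y : nrm y < r -> forall e, 0 < e ->
    exists2 w, nrm (T w) <= M & nrm (y - w) < e.
  move=> yr e e0; have e20 : 0 < e / 2 by rewrite divr_gt0.
  have [w1 Tw1 w1y] : exists2 w, nrm (T w) <= n%:R & nrm (y + x - w) < e / 2.
    by apply: ballr; rewrite // addrK.
  have [w2 Tw2 w2x] : exists2 w, nrm (T w) <= n%:R & nrm (x - w) < e / 2.
    by apply: ballr; rewrite // subrr nrm0.
  exists (w1 - w2).
    by rewrite TB (le_trans (nrmD _ _))// nrmN /M; lra.
  have -> : y - (w1 - w2) = (y + x - w1) - (x - w2).
    by rewrite !opprB [y + x - w1]addrAC -!addrA [x + _]addrC subrK [- w1 + _]addrC.
  by rewrite (le_lt_trans (nrmD _ _))// nrmN; lra.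
have approx k y : nrm y < r / 2 ^+ k -> forall e, 0 < e ->
    exists2 w, nrm (T w) <= M / 2 ^+ k & nrm (y - w) < e.
  move=> yr e e0.
  have c0 : 0 < 2 ^+ k :> R by rewrite exprn_gt0.
  set c : Cplx R := ((2 ^+ k : R)%:C)%C.
  have cn : nrm c = 2 ^+ k by rewrite nrmC_ge0// ltW.
  have cN0 : c != 0 by rewrite eq_complex /= gt_eqF.
  have [w Tw wy] : exists2 w, nrm (T w) <= M & nrm (c *: y - w) < e * 2 ^+ k.
    apply: approx0; last by rewrite mulr_gt0.
    by rewrite nrmZ cn mulrC -ltr_pdivlMr.
  exists (c^-1 *: w).
    by rewrite ler_pdivlMr// mulrC -cn -nrmZ -TZ scalerA mulfV// scale1r.
  rewrite -(ltr_pM2r c0) mulrC -cn -nrmZ scalerBr scalerA mulfV// scale1r.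
  by rewrite cn.
have bound k y : nrm y < r / 2 ^+ k -> nrm (T y) <= 2 * M / 2 ^+ k.
  move=> yr.
  have r2_gt0 m : 0 < r / 2 ^+ m by rewrite divr_gt0 ?exprn_gt0.
  have step (t : nat * V) : exists w, nrm t.2 < r / 2 ^+ (t.1 + k) ->
      nrm (T w) <= M / 2 ^+ (t.1 + k) /\ nrm (t.2 - w) < r / 2 ^+ (t.1 + k).+1.
    have [tr|] := boolP (nrm t.2 < r / 2 ^+ (t.1 + k)); last by exists 0.
    by have [w] := approx _ _ tr _ (r2_gt0 (t.1 + k).+1); exists w.
  have [f fP] := choice step.
  (* Partial sums of the corrections: each one approximates the remainder [y - s j] left by its
     predecessors. *)
  pose s := fix s m := if m is j.+1 then s j + f (j, y - s j) else 0 : V.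
  have ys m : nrm (y - s m) < r / 2 ^+ (m + k).
    elim: m => [|m IH] /=; first by rewrite subr0.
    by rewrite opprD addrA; have [] := fP (m, y - s m) IH.
  have [h hs] : exists h, forall m, nrm (h - T (s m)) <= 2 * M / 2 ^+ (m + k).
    apply: geometric_limit => m /=.
      rewrite -TB addrAC subrr add0r mulrAC [2 * M]mulrC mulfK ?pnatr_eq0//.
      by have [] := fP (m, y - s m) (ys m).
    by rewrite addSn exprSr invfM mulrA.
  have -> : T y = h.
    symmetry; apply: graphT => e e0.
    have M0 : 0 <= M by rewrite mulr_ge0.
    have : 0 <= r + 2 * M by rewrite addr_ge0 ?mulr_ge0// ltW.
    move=> /geometric_small => /(_ _ e0)[m me].
    have {me} : (r + 2 * M) / 2 ^+ (m + k) < e.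
      apply: le_lt_trans me; rewrite ler_wpM2l ?addr_ge0 ?mulr_ge0 ?(ltW r0)//.
      by rewrite lef_pV2 ?posrE ?exprn_gt0// ler_eXn2l ?ltr1n// leq_addr.
    rewrite mulrDl => me; exists (s m); split.
      apply: lt_trans (ys m) _; apply: le_lt_trans me.
      by rewrite lerDl divr_ge0 ?exprn_ge0// mulr_ge0.
    apply: le_lt_trans (hs m) _; apply: le_lt_trans me.
    by rewrite lerDr ltW.
  by have := hs 0%N; rewrite /= T0 subr0.
move=> f A /nbhs_nrmP[e e0 eA]; apply/nbhs_nrmP.
have [k ke] : exists k, 2 * M / 2 ^+ k < e.
  by apply: geometric_small => //; rewrite !mulr_ge0.
exists (r / 2 ^+ k); first by rewrite divr_gt0 ?exprn_gt0.
by move=> y /bound; rewrite TB => H; apply: eA; exact: le_lt_trans H ke.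
Qed.

End RealNorm.

(** * Submultiplicative seminorms and bounded characters *)

Section RealLemmas.
Variable R : realType.

Lemma ler_mulgtP (a b c : R) : 0 <= a -> 0 <= b ->
  (forall s t, a < s -> b < t -> c <= s * t) -> c <= a * b.
Proof.
move=> a0 b0 H; rewrite leNgt; apply/negP => abc.
(* For [d <= 1] one has [(a + d) * (b + d) <= a * b + d * (a + b + 1)]; with [d <= k] the excess is
   at most half of [c - a * b]. *)
set k := (c - a * b) / (2 * (a + b + 1)).
have k0 : 0 < k by rewrite divr_gt0//; nra.
have d1 : Num.min 1 k <= 1 by rewrite ge_min lexx.
have dk : Num.min 1 k <= k by rewrite ge_min lexx orbT.
have d0 : 0 < Num.min 1 k by rewrite lt_min ltr01.
have := H (a + Num.min 1 k) (b + Num.min 1 k).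
rewrite !ltrDl d0 => /(_ isT isT).
have : k * (2 * (a + b + 1)) = c - a * b by rewrite divfK//; lra.
nra.
Qed.

Lemma ge1_of_powers_ge (C r : R) : 0 <= r -> (forall i, 1 <= C * r ^+ i) ->
  1 <= r.
Proof.
move=> r0 H; rewrite leNgt; apply/negP => r1.
have C0 : 0 < C by have := H 0%N; rewrite expr0 mulr1; apply: lt_le_trans.
have rr : `|r| < 1 by rewrite ger0_norm.
have /cvgrPdist_lt /(_ C^-1) := cvg_expr rr.
rewrite invr_gt0 => /(_ C0)[n _ /(_ n (leqnn n))] /=.
rewrite sub0r normrN ger0_norm ?exprn_ge0// -[C^-1]mul1r ltr_pdivlMr// mulrC.
by rewrite ltNge H.
Qed.

Lemma expr_bound_right (m d : R) N : 0 < d ->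
  exists2 e, 0 < e & (m + e) ^+ N <= m ^+ N + d.
Proof.
move=> d0.
have /cvgrPdist_lt /(_ d d0) : x ^+ N @[x --> m] --> m ^+ N.
  exact: exprn_continuous.
move=> /nbhs_ballP[e /= e0 /(_ (m + e / 2))] H.
exists (e / 2); first by rewrite divr_gt0.
have : `|m ^+ N - (m + e / 2) ^+ N| < d.
  apply: H; rewrite /ball /= opprD addNKr normrN ger0_norm ?divr_ge0 ?ltW//.
  lra.
by rewrite ltr_distlC => /andP[_ /ltW].
Qed.
Lemma inf_nonneg_le (S : set R) x : (forall x, S x -> 0 <= x) -> S x -> inf S <= x.
Proof. by move=> Sge0 Sx; apply: ge_inf => //; exists 0. Qed.

Lemma inf_nonneg (S : set R) : (forall x, S x -> 0 <= x) -> 0 <= inf S.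
Proof.
move=> Sge0; have [->|S0] := eqVneq S set0; first by rewrite inf0.
by apply: lb_le_inf => //; exact/set0P.
Qed.

End RealLemmas.

Section AlgSeminorm.
Variables (R : realType) (A : comAlgType (Cplx R)).
Implicit Types (p q : A -> R) (x y a b : A) (z : Cplx R).

(** Homogeneity is stated as an inequality; scaling back by the inverse of [z] gives equality for
    nonzero [z]. *)
Definition seminorm p : Prop :=
  (forall x y, p (x + y) <= p x + p y) /\
  (forall z x, p (z *: x) <= nrm z * p x).

Definition alg_seminorm p : Prop :=
  [/\ seminorm p, forall x y, p (x * y) <= p x * p y & 1 <= p 1].

Section Theory.
Variable p : A -> R.
Hypothesis sp : seminorm p.

Lemma seminorm0 : p 0 = 0.
Proof.
case: sp => pD pZ; apply/eqP; rewrite eq_le.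
have := pZ 0 0; rewrite scale0r nrm0 mul0r => -> /=.
by have := pD 0 0; rewrite addr0 lerDl.
Qed.

Lemma seminormN x : p (- x) <= p x.
Proof.
by rewrite -scaleN1r (le_trans (sp.2 _ _))// nrmN nrmC_ge0 ?mul1r.
Qed.

Lemma seminormB x y : p (x - y) <= p x + p y.
Proof. by rewrite (le_trans (sp.1 _ _))// lerD2l seminormN. Qed.

Lemma seminorm_ge0 x : 0 <= p x.
Proof. by have := seminormB x x; rewrite subrr seminorm0; lra. Qed.

Lemma seminormMn x n : p (x *+ n) <= p x *+ n.
Proof.
elim: n => [|n IH]; first by rewrite !mulr0n seminorm0.
by rewrite !mulrS (le_trans (sp.1 _ _))// lerD2l.
Qed.

Lemma seminorm_sum n (F : 'I_n -> A) : p (\sum_i F i) <= \sum_i p (F i).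
Proof.
elim/big_ind2: _ => //; first by rewrite seminorm0.
by move=> x r y s xr ys; rewrite (le_trans (sp.1 _ _))// lerD.
Qed.

Hypothesis p1 : 1 <= p 1.

Lemma seminorm_scalar z : nrm z <= p (z%:A).
Proof.
have [->|z0] := eqVneq z 0; first by rewrite nrm0 seminorm_ge0.
have nz : 0 < nrm z.
  by rewrite lt_neqAle nrm_ge0 andbT eq_sym nrm_eq0.
have := sp.2 z^-1 (z%:A); rewrite scalerA mulVf// scale1r => H.
have zV : nrm z * nrm z^-1 = 1 by rewrite -nrmM mulfV// nrmC_ge0.
have := le_trans p1 H; rewrite -(ler_pM2l nz) mulr1 mulrA zV mul1r//.
Qed.

Hypothesis pM : forall x y, p (x * y) <= p x * p y.

Lemma seminormX x n : p (x ^+ n) <= p 1 * p x ^+ n.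
Proof.
elim: n => [|n IH]; first by rewrite !expr0 mulr1.
rewrite exprS (le_trans (pM _ _))// exprS mulrCA ler_wpM2l//.
exact: seminorm_ge0.
Qed.

Lemma seminormXS x n : p (x ^+ n.+1) <= p x ^+ n.+1.
Proof.
elim: n => [|n IH]; first by rewrite !expr1.
rewrite exprS (le_trans (pM _ _))// [leRHS]exprS ler_wpM2l//.
exact: seminorm_ge0.
Qed.

End Theory.

(** Members of the chain may fail to be submultiplicative: a product under [q] is bounded through
    another member [p]. This form serves both Zorn's lemma and the quotients in [minimal_mult]. *)
Lemma inf_alg_seminorm (F : set (A -> R)) :
  F !=set0 -> total_on F (fun p q => forall x, p x <= q x) ->
  (forall p, F p -> seminorm p /\ 1 <= p 1) ->
  (forall p, F p -> exists2 q, F q & forall x y, q (x * y) <= p x * p y) ->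
  alg_seminorm (fun x => inf [set p x | p in F]).
Proof.
move=> F0 Ftot Fsn FM.
have im0 x : [set p x | p in F] !=set0 by case: F0 => p Fp; exists (p x), p.
have ge0 x t : [set p x | p in F] t -> 0 <= t.
  by move=> [p Fp <-]; apply: seminorm_ge0; have [] := Fsn _ Fp.
have lo p x : F p -> inf [set p x | p in F] <= p x.
  by move=> Fp; apply: inf_nonneg_le; [exact: ge0|exists p].
(* Two infima are approached by a single member, the smaller of the two members chosen
   separately. *)
have hi x y s t : inf [set p x | p in F] < s -> inf [set p y | p in F] < t ->
    exists p, [/\ F p, p x < s & p y < t].
  move=> /(inf_lt (im0 x))[_ [p Fp <-] ps].
  move=> /(inf_lt (im0 y))[_ [q Fq <-] qt].
  have [pq|qp] := Ftot _ _ Fp Fq.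
    by exists p; split => //; exact: le_lt_trans qt.
  by exists q; split => //; exact: le_lt_trans ps.
have inf0 x : 0 <= inf [set p x | p in F] by apply: inf_nonneg; exact: ge0.
split.
- split=> [x y|z x].
    apply/ler_addgt0Pr => e e0.
    have ltD r : r < r + e / 2 by rewrite ltrDl divr_gt0.
    have [p [Fp px py]] := hi x y _ _ (ltD _) (ltD _).
    rewrite (le_trans (lo _ _ Fp))// (le_trans ((Fsn _ Fp).1.1 _ _))//; lra.
  apply: ler_mulgtP => //; first exact: nrm_ge0.
  move=> s t sz xt; have [p [Fp _ px]] := hi x x _ _ xt xt.
  have p0 := seminorm_ge0 (Fsn _ Fp).1 x.
  rewrite (le_trans (lo _ _ Fp))// (le_trans ((Fsn _ Fp).1.2 _ _))//.
  by rewrite ler_pM// ?nrm_ge0// ltW.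
- move=> x y; apply: ler_mulgtP => // s t xs yt.
  have [p [Fp px py]] := hi _ _ _ _ xs yt.
  have [q Fq qp] := FM _ Fp.
  rewrite (le_trans (lo _ _ Fq))// (le_trans (qp _ _))// ler_pM ?(ltW px) ?(ltW py)//.
  + exact: seminorm_ge0 (Fsn _ Fp).1 x.
  + exact: seminorm_ge0 (Fsn _ Fp).1 y.
- by apply: lb_le_inf => // _ [p Fp <-]; have [] := Fsn _ Fp.
Qed.

(* Equals the limit of [p (a ^+ n)] to the power 1 / n; in this form no n-th roots
   are needed. *)
Definition spectral_bound p a : set R :=
  [set r | 0 <= r /\ exists C, forall i, p (a ^+ i) <= C * r ^+ i].

Definition spectral_radius p a := inf (spectral_bound p a).

(** * The spectral radius as an algebra seminorm *)

Section SpectralRadius.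
Variable p : A -> R.
Hypothesis pP : alg_seminorm p.

Let sp : seminorm p. Proof. by case: pP. Qed.
Let pM x y : p (x * y) <= p x * p y. Proof. by case: pP. Qed.
Let p1 : 1 <= p 1. Proof. by case: pP. Qed.
Let p_ge0 := seminorm_ge0 sp.
Local Notation rho := (spectral_radius p).

Lemma spectral_radius_le a r : spectral_bound p a r -> rho a <= r.
Proof. by apply: inf_nonneg_le => ? []. Qed.

Lemma spectral_radius_le_norm a : rho a <= p a.
Proof.
apply: spectral_radius_le; split=> //; exists (p 1) => i.
exact: seminormX.
Qed.

Lemma spectral_radius_ge0 a : 0 <= rho a.
Proof. by apply: inf_nonneg => ? []. Qed.

Lemma spectral_radius_lt a s : rho a < s ->
  exists2 C, 0 <= C & forall i, p (a ^+ i) <= C * s ^+ i.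
Proof.
move=> /inf_lt[|r [r0 [C Cr]] rs].
  by exists (p a); split=> //; exists (p 1) => i; exact: seminormX.
have C0 : 0 <= C.
  by have := Cr 0%N; rewrite !expr0 mulr1; apply: le_trans.
exists C => // i; rewrite (le_trans (Cr i))// ler_wpM2l// lerXn2r ?nnegrE//.
- exact: le_trans (ltW rs).
- exact: ltW.
Qed.

(** Subadditivity comes from the binomial formula, products from [(x * y) ^+ i = x ^+ i * y ^+ i];
    both rest on commutativity. The powers of 1 are constant, so no rate below 1 bounds them. *)
Lemma spectral_radius_alg_seminorm : alg_seminorm rho.
Proof.
split; first split.
- move=> x y; apply/ler_addgt0Pr => e e0.
  have [C C0 Cx] : exists2 C, 0 <= C & forall i, p (x ^+ i) <= C * (rho x + e / 2) ^+ i.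
    by apply: spectral_radius_lt; rewrite ltrDl divr_gt0.
  have [D D0 Dy] : exists2 C, 0 <= C & forall i, p (y ^+ i) <= C * (rho y + e / 2) ^+ i.
    by apply: spectral_radius_lt; rewrite ltrDl divr_gt0.
  have x0 := spectral_radius_ge0 x; have y0 := spectral_radius_ge0 y.
  set s := rho x + e / 2 in Cx *; set t := rho y + e / 2 in Dy *.
  have -> : rho x + rho y + e = s + t by rewrite /s /t; lra.
  have s0 : 0 <= s by rewrite /s; lra.
  have t0 : 0 <= t by rewrite /t; lra.
  apply: spectral_radius_le; split; first exact: addr_ge0.
  exists (C * D) => i; rewrite !exprDn mulr_sumr.
  rewrite (le_trans (seminorm_sum sp _))// ler_sum// => j _.
  rewrite (le_trans (seminormMn sp _ _))// mulrnAr lerMn2r mulrACA.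
  by rewrite (le_trans (pM _ _)) ?orbT// ler_pM.
- move=> z x; apply: ler_mulgtP => [||s t zs xt].
  + exact: nrm_ge0.
  + exact: spectral_radius_ge0.
  have [C C0 Cx] := spectral_radius_lt xt.
  have t0 : 0 <= t := le_trans (spectral_radius_ge0 x) (ltW xt).
  have s0 : 0 <= s := le_trans (nrm_ge0 z) (ltW zs).
  apply: spectral_radius_le; split; first exact: mulr_ge0.
  exists C => i; rewrite exprZn (le_trans (sp.2 _ _))// exprMn mulrCA.
  rewrite ler_pM ?nrm_ge0//.
  by rewrite nrmX lerXn2r ?nnegrE ?nrm_ge0// ltW.
- move=> x y; apply: ler_mulgtP => [||s t xs yt].
  + exact: spectral_radius_ge0.
  + exact: spectral_radius_ge0.
  have [C C0 Cx] := spectral_radius_lt xs.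
  have [D D0 Dy] := spectral_radius_lt yt.
  apply: spectral_radius_le; split.
    apply: mulr_ge0; apply: ltW; [apply: le_lt_trans xs|apply: le_lt_trans yt];
    exact: spectral_radius_ge0.
  exists (C * D) => i.
  by rewrite !exprMn mulrACA (le_trans (pM _ _))// ler_pM.
- apply: lb_le_inf.
    exists (p 1); split=> //; exists (p 1) => i; exact: seminormX.
  move=> r [r0 [C Cr]]; apply: (@ge1_of_powers_ge _ C) => // i.
  by have := Cr i; rewrite expr1n; apply: le_trans.
Qed.

End SpectralRadius.
End AlgSeminorm.

(** * Minimal algebra seminorms and their multiplicativity *)

Section MinimalSeminorm.
Variables (R : realType) (A : comAlgType (Cplx R)).
Implicit Types (p q : A -> R) (x y a b : A) (z : Cplx R).

Definition minimal_seminorm p : Prop := alg_seminorm p /\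
  forall q, alg_seminorm q -> (forall x, q x <= p x) -> forall x, p x <= q x.

Lemma minimal_seminorm_exists p : alg_seminorm p ->
  exists2 q, minimal_seminorm q & forall x, q x <= p x.
Proof.
move=> pP.
pose P q := alg_seminorm q /\ forall x, q x <= p x.
pose T := {q | P q}.
have Pp : P p by [].
(* The order is reversed, so that a maximal element for Zorn is a minimal seminorm. *)
pose below (q r : T) := `[< forall x, sval r x <= sval q x >].
have [||F Ftot|q qmin] := @ZL_preorder T (exist P p Pp) below.
- by move=> t; apply/asboolP.
- by move=> r s t /asboolP rs /asboolP st; apply/asboolP => x; exact: le_trans (rs x).
- have [->|/set0P[q0 Fq0]] := eqVneq F set0.
    by exists (exist P p Pp).
  pose G := [set sval q | q in F].
  have GP : alg_seminorm (fun x => inf [set r x | r in G]).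
    apply: inf_alg_seminorm.
    + by exists (sval q0), q0.
    + move=> _ _ [q Fq <-] [r Fr <-].
      by have [/asboolP|/asboolP] := Ftot _ _ Fq Fr; [right|left].
    + by move=> _ [q Fq <-]; have [[? _ ?] _] := svalP q.
    + by move=> _ [q Fq <-]; exists (sval q); [exists q|have [[]] := svalP q].
  have lo (q : T) x : F q -> inf [set r x | r in G] <= sval q x.
    move=> Fq; apply: inf_nonneg_le.
      by move=> _ [_ [r Fr <-] <-]; have [[/seminorm_ge0]] := svalP r.
    by exists (sval q) => //; exists q.
  have le x : inf [set r x | r in G] <= p x.
    by rewrite (le_trans (lo _ _ Fq0))//; have [] := svalP q0.
  exists (exist P _ (conj GP le)) => q Fq; apply/asboolP => x; exact: lo.
- case: q qmin => q [qP qp] qmin; exists q => //; split=> // r rP rq.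
  have rp x : r x <= p x by exact: le_trans (qp x).
  have /asboolP := qmin (exist P r (conj rP rp)) (introT (asboolP _) rq).
  exact.
Qed.

Section Minimal.
Variable p : A -> R.
Hypothesis pmin : minimal_seminorm p.

Let pP : alg_seminorm p. Proof. by case: pmin. Qed.
Let sp : seminorm p. Proof. by case: pP. Qed.
Let pM x y : p (x * y) <= p x * p y. Proof. by case: pP. Qed.
Let p1 : 1 <= p 1. Proof. by case: pP. Qed.
Let p_ge0 := seminorm_ge0 sp.

Lemma minimal_le_spectral_radius a : p a <= spectral_radius p a.
Proof.
apply: pmin.2; first exact: spectral_radius_alg_seminorm.
exact: spectral_radius_le_norm.
Qed.

(** Minimality gives [p a <= spectral_radius p a], so it suffices that every [t] above the square
    root of [p (a ^+ 2)] is a growth rate for the powers of [a]. *)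
Lemma minimal_sqr a : p a ^+ 2 <= p (a ^+ 2).
Proof.
suff : p a <= Num.sqrt (p (a ^+ 2)).
  by move=> H; rewrite -[leRHS]sqr_sqrtr// lerXn2r ?nnegrE// sqrtr_ge0.
apply/ler_addgt0Pr => e e0; set t := _ + e.
have t0 : 0 < t by rewrite ltr_wpDl// sqrtr_ge0.
have pt : p (a ^+ 2) <= t ^+ 2.
  rewrite -[leLHS]sqr_sqrtr// lerXn2r ?nnegrE ?sqrtr_ge0 ?(ltW t0)//.
  by rewrite lerDl ltW.
apply: le_trans (minimal_le_spectral_radius a) _.
apply: spectral_radius_le; split; first exact: ltW.
have p10 : 0 <= p 1 := le_trans ler01 p1.
have pat : 0 <= p a / t by rewrite divr_ge0// ltW.
(* Even powers need only the constant [p 1]; an odd power has one extra factor [a], which costs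
   [p a / t]. *)
exists (p 1 * (1 + p a / t)) => i.
have even k : p (a ^+ (k.*2)) <= p 1 * t ^+ k.*2.
  rewrite -mul2n !exprM (le_trans (seminormX sp pM _ _))//.
  by rewrite ler_wpM2l// lerXn2r ?nnegrE// exprn_ge0// ltW.
rewrite -(odd_double_half i); case: (odd i) => /=; last first.
  rewrite add0n (le_trans (even _))// ler_wpM2r ?exprn_ge0 ?(ltW t0)//.
  by rewrite ler_peMr// lerDl.
rewrite add1n exprSr (le_trans (pM _ _))// exprS.
have := ler_wpM2r (p_ge0 a) (even i./2).
have tk : 0 <= t ^+ (i./2).*2 by rewrite exprn_ge0// ltW.
move=> /le_trans; apply.
have -> : p 1 * (1 + p a / t) * (t * t ^+ (i./2).*2) =
    p 1 * t ^+ (i./2).*2 * t + p 1 * t ^+ (i./2).*2 * p a.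
  by field; rewrite gt_eqF.
by rewrite lerDr !mulr_ge0// ltW.
Qed.

Lemma minimal_power a n : p a ^+ n <= p (a ^+ n).
Proof.
have [pa0|pa0] := eqVneq (p a) 0.
  by rewrite pa0; case: n => [|n]; rewrite ?expr0// expr0n /=.
have {}pa0 : 0 < p a by rewrite lt_neqAle eq_sym pa0 p_ge0.
have pow2 k : p a ^+ (2 ^ k) <= p (a ^+ (2 ^ k)).
  elim: k => [|k IH]; first by rewrite !expr1.
  rewrite expnSr !exprM (le_trans _ (minimal_sqr _))//.
  by rewrite lerXn2r ?nnegrE ?exprn_ge0.
(* The exponent [n] is completed to a power of 2, and the surplus [p a ^+ k.+1] is cancelled. A
   positive surplus lets [seminormXS] apply, without a factor [p 1]. *)
have [k nk] : exists k, (2 ^ n = k.+1 + n)%N.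
  by exists (2 ^ n - n.+1)%N; rewrite addSnnS subnK// ltn_expl.
have := pow2 n; rewrite nk !exprD => H.
have := le_trans H (le_trans (pM _ _) (ler_wpM2r (p_ge0 _) (seminormXS sp pM a k))).
by rewrite ler_pM2l// exprn_gt0.
Qed.

(* The infimum of the decreasing sequence [p (y * a ^+ n) / p a ^+ n] is again an
   admissible seminorm below [p], hence equal to [p]; compare with the term
   n = 1. *)
Lemma minimal_mult a x : p (x * a) = p x * p a.
Proof.
apply/eqP; rewrite eq_le pM /=.
have [->|pa0] := eqVneq (p a) 0; first by rewrite mulr0.
have {}pa0 : 0 < p a by rewrite lt_neqAle eq_sym pa0 p_ge0.
have pan0 n : 0 < p a ^+ n by rewrite exprn_gt0.
pose f n y := p (y * a ^+ n) / p a ^+ n.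
pose F := range f.
have f_dec k n y : f (k + n)%N y <= f n y.
  elim: k => [|k IH] //; apply: le_trans IH.
  rewrite /f addSn !exprSr [y * _]mulrA ler_pdivrMr ?mulr_gt0//.
  by rewrite mulrA divfK ?gt_eqF// pM.
have FP : alg_seminorm (fun y => inf [set g y | g in F]).
  apply: inf_alg_seminorm.
  - by exists (f 0%N), 0%N.
  - move=> _ _ [n _ <-] [m _ <-].
    by case: (leqP n m) => [nm|/ltnW nm]; [right|left] => y; rewrite -(subnK nm).
  - move=> _ [n _ <-]; split; last first.
      by rewrite /f mul1r ler_pdivlMr// mul1r minimal_power.
    split=> [y z|z y].
      by rewrite /f mulrDl -[leRHS]mulrDl ler_pM2r ?invr_gt0// sp.1.
    by rewrite /f -scalerAl mulrA ler_pM2r ?invr_gt0// sp.2.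
  (* At index [n + n] the power of [a] splits evenly between [y] and [z]. *)
  - move=> _ [n _ <-]; exists (f (n + n)%N); first by exists (n + n)%N.
    move=> y z; rewrite /f exprD [y * z * _]mulrACA [p a ^+ _]exprD invfM.
    by rewrite [leRHS]mulrACA ler_pM2r ?mulr_gt0 ?invr_gt0.
have lo n y : inf [set g y | g in F] <= f n y.
  apply: inf_nonneg_le; last by exists (f n) => //; exists n.
  by move=> _ [_ [m _ <-] <-]; rewrite divr_ge0// ltW.
have : p x <= f 1%N x.
  apply: le_trans (lo _ _); apply: (pmin.2 _ FP) => y.
  by have := lo 0%N y; rewrite /f !expr0 mulr1 divr1.
by rewrite /f !expr1 ler_pdivlMr.
Qed.

End Minimal.

(* Ostrowski: the distance of [a] to the scalars cannot be positive, because
   the set of near-minimisers of [p (a - z)] would be stable under translation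
   by a fixed step. *)
Section GelfandMazur.
Variable p : A -> R.
Hypothesis sp : seminorm p.
Hypothesis pM : forall x y, p (x * y) = p x * p y.
Hypothesis p1 : 1 <= p 1.

Let p_ge0 := seminorm_ge0 sp.

Let p1E : p 1 = 1.
Proof.
have p10 : p 1 != 0 by rewrite gt_eqF// (lt_le_trans ltr01).
by apply: (mulfI p10); rewrite mulr1 -pM mulr1.
Qed.

Let pX x n : p (x ^+ n) = p x ^+ n.
Proof. by elim: n => [|n IH]; rewrite ?expr0// !exprS pM IH. Qed.

(* [b ^+ n.+1 - z ^+ n.+1] factors into n + 1 terms [b - w], one of them [b - z]
   and each of the others of size at least [m]. *)
Lemma ostrowski_bound m b z n : 0 <= m -> (forall w, m <= p (b - w%:A)) ->
  p (b - z%:A) * m ^+ n <= p b ^+ n.+1 + nrm z ^+ n.+1.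
Proof.
move=> m0 mb.
pose P : {poly Cplx R} := 'X^(n.+1) - (z ^+ n.+1)%:P.
have [rs PE] := closed_field_poly_normal P.
have lP : lead_coef P = 1 by apply/eqP; rewrite -monicE; exact: monicXnsubC.
rewrite lP scale1r in PE.
have size_rs : size rs = n.+1.
  by have := size_XnsubC (z ^+ n.+1) (ltn0Sn n); rewrite -/P PE size_prod_XsubC => -[].
have zrs : z \in rs.
  by rewrite -root_prod_XsubC -PE rootE !hornerE subrr.
have : b ^+ n.+1 - (z ^+ n.+1)%:A = \prod_(w <- rs) (b - w%:A).
  have := congr1 (horner_alg b) PE; rewrite rmorph_prod /P rmorphB rmorphXn /=.
  rewrite ?in_algE horner_algX horner_algC => ->.
  by apply: eq_bigr => w _; rewrite rmorphB /= horner_algX horner_algC.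
move=> /(congr1 p) E.
rewrite -nrmX -pX; apply: (@le_trans _ _ (p (b ^+ n.+1 - (z ^+ n.+1)%:A))); last first.
  rewrite (le_trans (seminormB sp _ _))// lerD2l (le_trans (sp.2 _ _))//.
  by rewrite p1E mulr1.
rewrite E (perm_big _ (perm_to_rem zrs)) big_cons pM ler_wpM2l//.
have : size (rem z rs) = n by rewrite size_rem// size_rs.
elim: (rem z rs) n {zrs size_rs P PE lP E} => [|w s IH] [|n] //=.
  by rewrite big_nil p1E expr0.
by move=> [/IH H]; rewrite big_cons pM exprS ler_pM// exprn_ge0.
Qed.

(** In [ostrowski_bound] take [z = m / 2]: after division by [m ^+ n] the term in [z] decays like
    [m / 2 ^+ n.+1]. First [n] makes it at most [d / 2], then [e] makes the excess of [p b ^+ n.+1]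
    at most [d / 2]. *)
Lemma ostrowski_step m d : 0 < m -> 0 < d -> exists2 e, 0 < e &
  forall b, (forall w, m <= p (b - w%:A)) -> p b <= m + e ->
  p (b - ((m / 2)%:C%C : Cplx R)%:A) <= m + d.
Proof.
move=> m0 d0.
have [n nd] := geometric_small (ltW m0) (divr_gt0 d0 (ltr0Sn R 1)).
have mn0 : 0 < m ^+ n by rewrite exprn_gt0.
have d20 : 0 < m ^+ n * (d / 2) by rewrite mulr_gt0// divr_gt0.
have [e e0 He] := expr_bound_right m n.+1 d20.
exists e => // b mb be.
have := ostrowski_bound ((m / 2)%:C%C : Cplx R) n (ltW m0) mb.
rewrite nrmC_ge0 ?divr_ge0 ?(ltW m0)// => H.
have pbe : p b ^+ n.+1 <= (m + e) ^+ n.+1.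
  by rewrite lerXn2r ?nnegrE// addr_ge0 ?ltW.
have half : (m / 2) ^+ n.+1 <= m ^+ n * (d / 2).
  rewrite expr_div_n [m ^+ n.+1]exprSr -mulrA ler_pM2l// (le_trans _ (ltW nd))//.
  rewrite ler_pM2l// lef_pV2 ?posrE ?exprn_gt0//.
  by rewrite exprS ler_peMl ?exprn_ge0// ler1n.
rewrite -(ler_pM2r mn0) (le_trans H)//.
have -> : (m + d) * m ^+ n = m ^+ n.+1 + m ^+ n * (d / 2) + m ^+ n * (d / 2).
  by rewrite exprS; lra.
by rewrite lerD// (le_trans pbe).
Qed.

Lemma ostrowski_steps m k d : 0 < m -> 0 < d -> exists2 e, 0 < e &
  forall b, (forall w, m <= p (b - w%:A)) -> p b <= m + e ->
  p (b - (k%:R * (m / 2)%:C%C : Cplx R)%:A) <= m + d.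
Proof.
move=> m0; elim: k d => [|k IH] d d0.
  by exists d => // b _; rewrite mul0r scale0r subr0.
have [e1 /IH[e e0 He] He1] := ostrowski_step m0 d0.
exists e => // b mb be; rewrite mulrSr mulrDl mul1r scalerDl opprD addrA.
apply: He1 => [w|]; last exact: He.
by rewrite -addrA -opprD -scalerDl.
Qed.

Lemma gelfand_mazur_approx a e : 0 < e -> exists z, p (a - z%:A) < e.
Proof.
move=> e0; apply/not_existsP => far.
pose S := range (fun z => p (a - z%:A)).
have S0 : S !=set0 by exists (p (a - 0%:A)), 0.
set m := inf S.
have m0 : 0 < m.
  apply: lt_le_trans e0 _; apply: lb_le_inf => // _ [z _ <-].
  by rewrite leNgt; apply/negP; exact: far.
have mS z : m <= p (a - z%:A).
  by apply: inf_nonneg_le => [_ [w _ <-]//|]; exists z.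
(* Both [b] and its translate after [k] steps will have seminorm at most [m + 1], so the total shift
   is at most [2 * m + 2]; this [k] contradicts that. *)
have [k mk] : exists k, 2 * m + 2 < k%:R * (m / 2).
  exists (Num.truncn ((2 * m + 2) / (m / 2))).+1.
  by rewrite -ltr_pdivrMr ?divr_gt0// truncnS_gt.
have [d d0 Hd] := ostrowski_steps k m0 ltr01.
have [_ [z _ <-] zm] : exists2 y, S y & y < m + Num.min d 1.
  by apply: inf_lt => //; rewrite ltrDl lt_min d0 ltr01.
set b := a - z%:A in zm.
have mb w : m <= p (b - w%:A) by rewrite /b -addrA -opprD -scalerDl.
have mind : Num.min d 1 <= d by rewrite ge_min lexx.
have min1 : Num.min d 1 <= 1 by rewrite ge_min lexx orbT.
have := Hd b mb (le_trans (ltW zm) (lerD (lexx m) mind)).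
set w : Cplx R := _ * _ => bw.
have wn : nrm w = k%:R * (m / 2).
  rewrite /w nrmM nrmC_ge0 ?divr_ge0 ?(ltW m0)//.
  by rewrite -(rmorph_nat (real_complex R)) nrmC_ge0.
have := seminorm_scalar sp p1 w; rewrite wn.
have -> : w%:A = b - (b - w%:A) by rewrite opprB addrC subrK.
by have := seminormB sp b (b - w%:A); lra.
Qed.

(** By [seminorm_scalar], scalars that approximate [a] well are close to each other; their limit in
    the complex numbers is the required [z]. *)
Lemma gelfand_mazur a : exists z, p (a - z%:A) = 0.
Proof.
(* The factor 1/4 keeps the sum of two consecutive errors below half of [1 / 2 ^+ n], as
   [geometric_limit] demands. *)
have r_gt0 n : 0 < (1 / 2 ^+ n : R) / 4 by rewrite !divr_gt0 ?exprn_gt0.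
have [u uP] := choice (fun n => gelfand_mazur_approx a (r_gt0 n)).
have [||l lu] := @geometric_limit R (Cplx_space R) u (fun n => 1 / 2 ^+ n).
- move=> n; rewrite (le_trans (seminorm_scalar sp p1 _))//.
  have -> : (u n.+1 - u n)%:A = (a - (u n)%:A) - (a - (u n.+1)%:A) :> A.
    by rewrite scalerBl opprB [a - _]addrC addrACA subrr addr0 addrC.
  rewrite (le_trans (seminormB sp _ _))//.
  have := uP n; have := uP n.+1; have := r_gt0 n.
  rewrite exprSr invfM mulrA; lra.
- by move=> n; rewrite exprSr invfM mulrA.
exists l; apply/eqP; rewrite eq_le p_ge0 andbT leNgt; apply/negP => al.
have [n] := geometric_small (ler0n R 2) al.
apply/negP; rewrite -leNgt.
have -> : a - (l : Cplx R)%:A = (a - (u n)%:A) - ((l : Cplx R) - u n)%:A.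
  by rewrite scalerBl opprB addrA subrK.
rewrite (le_trans (seminormB sp _ _))//.
have : p (((l : Cplx R) - u n)%:A) <= 1 / 2 ^+ n.
  by rewrite (le_trans (sp.2 _ _))// p1E mulr1; exact: lu.
by have := uP n; have := r_gt0 n; lra.
Qed.

End GelfandMazur.

(** Since [q] dominates the modulus on scalars, the [z] with [q (a - z%:A) = 0] is unique; each
    algebraic identity for [chi] follows by checking that the expected value qualifies. *)
Theorem seminorm_character_exists p : alg_seminorm p ->
  exists chi : A -> Cplx R, [/\ scalar chi,
    forall a b, chi (a * b) = chi a * chi b,
    chi 1 = 1 & forall a, nrm (chi a) <= p a].
Proof.
move=> /minimal_seminorm_exists[q qmin qp].
have [sq _ q1] := qmin.1.
have qM x y := minimal_mult qmin y x.
have [chi chiP] := choice (gelfand_mazur sq qM q1).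
have uniq a z : q (a - z%:A) <= 0 -> chi a = z.
  move=> az; apply/eqP; rewrite -subr_eq0 -nrm_eq0 eq_le nrm_ge0 andbT.
  rewrite (le_trans (seminorm_scalar sq q1 _))//.
  have -> : (chi a - z)%:A = (a - z%:A) - (a - (chi a)%:A).
    by rewrite scalerBl opprB [a - _]addrC addrACA subrr addr0 addrC.
  by rewrite (le_trans (seminormB sq _ _))// chiP addr0.
exists chi; split=> [z a b|a b||a].
- apply: uniq.
  have -> : z *: a + b - (z * chi a + chi b)%:A =
      z *: (a - (chi a)%:A) + (b - (chi b)%:A).
    by rewrite scalerDl scalerBr scalerA opprD addrACA.
  by rewrite (le_trans (sq.1 _ _))// chiP addr0 (le_trans (sq.2 _ _))// chiP mulr0.
- apply: uniq.
  have -> : a * b - (chi a * chi b)%:A =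
      (a - (chi a)%:A) * b + chi a *: (b - (chi b)%:A).
    by rewrite mulrBl -scalerAl mul1r scalerBr scalerA addrA subrK.
  rewrite (le_trans (sq.1 _ _))// qM chiP mul0r add0r (le_trans (sq.2 _ _))//.
  by rewrite chiP mulr0.
- by apply: uniq; rewrite scale1r subrr seminorm0.
- apply: le_trans (qp a); rewrite (le_trans (seminorm_scalar sq q1 _))//.
  have -> : (chi a)%:A = a - (a - (chi a)%:A) by rewrite opprB addrC subrK.
  by rewrite (le_trans (seminormB sq _ _))// chiP addr0.
Qed.

End MinimalSeminorm.

(** * Transport of the Ditkin property *)

Section Pullback.
Variables (R : realType) (A A' : comCompleteAlg (Cplx R)).
Variable h : A' -> A.
Hypotheses (h_linear : linear h) (h_mult : monoid_morphism h).

Lemma pullback_characters (phi : char_space A) :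
  characters (A := A') (fun a => gelfand (h a) phi).
Proof.
have [phi_lin phi_mul [a phia]] := set_mem (valP phi).
split=> [k x y|x y|]; rewrite /gelfand.
- by rewrite h_linear phi_lin.
- by rewrite h_mult.2 phi_mul.
- exists 1; rewrite h_mult.1; apply: contra_neq phia => phi1.
  by rewrite -[a]mulr1 phi_mul phi1 mulr0.
Qed.

Definition pullback (phi : char_space A) : char_space A' :=
  SigSub (mem_set (pullback_characters phi)).

(** Tested coordinatewise: the coordinate at [a] of the pullback is evaluation at [h a]. *)
Lemma pullback_continuous : continuous pullback.
Proof.
apply: continuous_comp_initial => phi.
have FF : Filter ((set_val \o pullback : char_space A ->
    {ptws A' -> Cplx R}) @ nbhs phi).
  by apply: fmap_filter; exact: nbhs_filter.
apply: (proj2 (@pointwise_cvgP A' (Cplx R) _ _ FF)) => a.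
have : continuous ((fun f : {ptws A -> Cplx R} => f (h a)) \o
    (val : char_space A -> {ptws A -> Cplx R})).
  move=> psi; apply: continuous_comp; first exact: initial_continuous.
  exact: (@proj_continuous A (fun=> Cplx R) (h a)).
exact.
Qed.

Lemma J_at_pullback phi b : J_at (pullback phi) b -> J_at phi (h b).
Proof.
apply: contra_not => supp_hb B /pullback_continuous /supp_hb[psi [psib Bpsi]].
by exists (pullback psi).
Qed.

Lemma ditkin_retract (s : A -> A') :
  continuous h -> cancel s h -> ditkin A' -> ditkin A.
Proof.
move=> h_cont sK A'ditkin phi a Ia B Ba.
have Isa : I_at (pullback phi) (s a) by rewrite /I_at /gelfand /= sK.
have nBa : nbhs (s a) (h @^-1` B) by apply: h_cont; rewrite sK.
have [_ [[b Jb <-] /= Bb]] := A'ditkin _ _ Isa _ nBa.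
exists (a * h b); split; last by rewrite -[a in a * _]sK -h_mult.2.
by exists (h b) => //; exact: J_at_pullback.
Qed.

End Pullback.

(** * Characters of a Banach algebra, and the two retractions of the quadruple *)

Lemma nrm_alg_seminorm (R : realType) (E : comBanachAlg (Cplx R)) :
  alg_seminorm (fun a : E => nrm a).
Proof.
have nM (a b : E) : nrm (a * b) <= nrm a * nrm b.
  by rewrite -lecR rmorphM /= -!nrmE; exact: cba_normM.
split=> //; first by split=> [a b|z a]; [exact: nrmD|rewrite nrmZ].
have : 0 < nrm (1 : E).
  by rewrite lt_neqAle nrm_ge0 andbT eq_sym nrm_eq0 oner_neq0.
by move=> n1; rewrite -(ler_pM2l n1) mulr1 (le_trans _ (nM 1 1))// mulr1.
Qed.

(** The definition of [characters] contains no bound; this one is used to verify the closed graph of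
    composition with [lam]. *)
Lemma bounded_char_exists (R : realType) (E : comBanachAlg (Cplx R)) :
  exists lam : char_space E, forall a, nrm (gelfand a lam) <= nrm a.
Proof.
have [chi [chi_lin chi_mul chi1 chi_le]] :=
  seminorm_character_exists (nrm_alg_seminorm E).
have chiP : characters (A := E) chi.
  by split=> //; exists 1; rewrite chi1 oner_neq0.
by exists (SigSub (mem_set chiP)).
Qed.

(** Over an empty space all functions coincide, and injectivity of [fa_val] would force 1 = 0. *)
Lemma function_algebra_inhabited (R : realType) (X : topologicalType)
    (E : comBanachAlg (Cplx R)) (A : function_algebra X E) : inhabited X.
Proof.
apply: contrapT => X0; have : (1 : A) != 0 by exact: oner_neq0.
move=> /eqP; apply; apply: fa_inj; apply/funext => x.
by exfalso; apply: X0; exists.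
Qed.

Theorem proposition2p1 (R : realType) (X : topologicalType)
    (E : comBanachAlg (Cplx R)) (B : function_algebra X (Cplx_alg R))
    (Bt : function_algebra X E) :
  admissible B Bt -> ditkin Bt -> ditkin E /\ ditkin B.
Proof.
move=> [_ _ _ BE_sub comp_sub] Bt_ditkin; split.
- have [x] := function_algebra_inhabited Bt.
  have const_Bt a : exists f : Bt, fa_val f = cst a.
    have [|f _ fE] := BE_sub (fun=> 1) a.
      by exists 1 => //; exact: (fa_mult B).1.
    by exists f; rewrite fE; apply/funext => y; rewrite scale1r.
  have [s sE] := choice const_Bt.
  apply: (@ditkin_retract _ E Bt (fun f => fa_val f x) _ _ s) => //.
  + by move=> k f g; rewrite fa_linear.
  + by split=> [|f g]; rewrite ?(fa_mult Bt).1// (fa_mult Bt).2.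
  + exact: fa_eval_continuous.
  + by move=> a; rewrite sE.
- have [lam lam_le] := bounded_char_exists E.
  have [lam_lin lam_mul [a0 lama0]] := set_mem (valP lam).
  have lam1 : gelfand 1 lam = 1.
    apply: (mulIf lama0); rewrite mul1r.
    by rewrite /gelfand -lam_mul mul1r.
  have lamB a b : gelfand (a - b) lam = gelfand a lam - gelfand b lam.
    by rewrite /gelfand -scaleN1r addrC lam_lin mulN1r addrC.
  have lamZ k a : gelfand (k *: a) lam = k * gelfand a lam.
    have := lamB 0 0; rewrite !subrr => lam0.
    by rewrite -[k *: a]addr0 /gelfand lam_lin [\val lam 0]lam0 addr0.
  have comp (f : Bt) : exists g : B, forall x, fa_val g x = gelfand (fa_val f x) lam.
    have [|g _ gE] := comp_sub (fa_val f) lam; first by exists f.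
    by exists g => x; rewrite gE.
  have [T TE] := choice comp.
  have tensor (g : B) : exists f : Bt, forall x, fa_val f x = (fa_val g x : Cplx R) *: (1 : E).
    have [|f _ fE] := BE_sub (fa_val g) 1; first by exists g.
    by exists f => x; rewrite fE.
  have [s sE] := choice tensor.
  have T_lin : linear T.
    move=> k f g; apply: fa_inj; apply/funext => x.
    by rewrite fa_linear TE !fctE !TE fa_linear /gelfand lam_lin.
  have T_mult : monoid_morphism T.
    split=> [|f g]; apply: fa_inj; apply/funext => x.
      by rewrite TE !(fa_mult _).1.
    by rewrite (fa_mult B).2 TE !fctE !TE (fa_mult Bt).2 /gelfand lam_mul.
  apply: (@ditkin_retract _ B Bt T _ _ s) => //; last first.
    move=> g; apply: fa_inj; apply/funext => x; rewrite TE sE.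
    by rewrite lamZ lam1 mulr1.
  (* The graph is closed because evaluations are continuous: at [x], a common approximant [k] brings
     [lam (k x)] close to [lam (f x)], as [lam] is contractive, and close to [g x], as it is the
     value of [T k]. *)
  apply: closed_graph => // f g approx.
  apply: fa_inj; apply/funext => x.
  rewrite TE; apply/eqP; rewrite -subr_eq0 -nrm_eq0 eq_le nrm_ge0 andbT.
  apply/ler_addgt0Pr => e e0; rewrite add0r.
  have e20 : 0 < e / 2 by rewrite divr_gt0.
  have near_val (Y : comBanachAlg (Cplx R)) (C : function_algebra X Y) (u : C) :
      exists2 d, 0 < d & forall v, nrm (u - v) < d ->
      nrm (fa_val u x - fa_val v x) < e / 2.
    have : nbhs (fa_val u x) [set w | nrm (fa_val u x - w) < e / 2].
      by apply/nbhs_nrmP; exists (e / 2).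
    by move=> /(@fa_eval_continuous _ _ _ C x u)/nbhs_nrmP.
  have [d1 d10 near_f] := near_val _ _ f.
  have [d2 d20 near_g] := near_val _ _ g.
  have [|k [fk gk]] := approx (Num.min d1 d2); first by rewrite lt_min d10.
  move: fk gk; rewrite !lt_min => /andP[/near_f fk _] /andP[_ /near_g].
  rewrite TE => gk.
  rewrite (le_trans (nrm_triangle (gelfand (fa_val k x) lam) _ _))//.
  rewrite [e]splitr lerD ?(ltW gk)// -lamB (le_trans (lam_le _))//.
  rewrite nrmB; exact: ltW.
Qed.
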